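(* Let $m\ge2$, $n\ge1$, let $\mathcal A\in\mathbb T(\mathbb C^n,m)$ be a tensor having $0$ as an eigenvalue, and let $P\in\mathbb O(n,\mathbb C)$. Then the eigenvarieties $V_{\mathcal A}(0)$ and $V_{P\cdot\mathcal A}(0)$ of the zero eigenvalue have the same number of irreducible components, and the dimensions of these irreducible components (as a multiset) are the same. In particular, the geometric multiplicity of the zero eigenvalue is the same for $\mathcal A$ and for $P\cdot\mathcal A$.
   Context: $\mathbb T(\mathbb C^n,m)=\otimes^m\mathbb C^n$ is the space of $m$-th order $n$-dimensional complex tensors $\mathcal A=(a_{i_1\ldots i_m})$. $\mathbb O(n,\mathbb C)=\{P\in\mathbb C^{n\times n}:PP^{\mathsf T}=I\}$ acts on $\mathbb T(\mathbb C^n,m)$ by $$(P\cdot\mathcal A)_{i_1\dots i_m}=\sum_{j_1,\dots,j_m=1}^n a_{j_1\dots j_m}p_{i_1j_1}\cdots p_{i_mj_m}.$$ For $\mathbf x\in\mathbb C^n$, $\mathcal A\mathbf x^{m-1}\in\mathbb C^n$ has $i$-th entry $\sum_{i_2,\dots,i_m=1}^n a_{ii_2\ldots i_m}x_{i_2}\cdots x_{i_m}$, and $\mathbf x^{[m-1]}$ has $i$-th entry $x_i^{m-1}$. A number $\lambda\in\mathbb C$ is an eigenvalue of $\mathcal A$ if there is $\mathbf x\neq\mathbf 0$ with $\mathcal A\mathbf x^{m-1}=\lambda\mathbf x^{[m-1]}$. The eigenvariety is $V_{\mathcal A}(\lambda)=\{\mathbf x\in\mathbb C^n:\mathcal A\mathbf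 x^{m-1}=\lambda\mathbf x^{[m-1]}\}$ (with $\mathbf 0$ included), an affine variety in $\mathbb C^n$. The geometric multiplicity of $\lambda$ is $\dim V_{\mathcal A}(\lambda)$. *)

(* Defs.v *)
From HB Require Import structures.
From mathcomp Require Import all_boot all_order all_algebra.
From mathcomp Require mpoly.
From mathcomp Require Import complex.
From mathcomp Require Import boolp classical_sets functions cardinality.
From mathcomp Require Import reals ereal.
Set Implicit Arguments.
Unset Strict Implicit.
Unset Printing Implicit Defensive.
Import Order.TTheory GRing.Theory Num.Theory.
Local Open Scope classical_set_scope.
Local Open Scope card_scope.
Local Open Scope ring_scope.

(* The field of complex numbers is R[i] for R : realType; the algebraic
   definitions below are stated over an arbitrary commutative ring C. *)

Section Tensors.
Variables (C : comNzRingType) (n m : nat).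

(* T(C^n, m): the entry of A at the multi-index j = (j_1, ..., j_m) is A j. *)
Definition tensor := {ffun m.-tuple 'I_n -> C}.

Definition orthogonal_group : set 'M[C]_n := [set P | P *m P^T = 1%:M].

Definition tensor_act (P : 'M[C]_n) (A : tensor) : tensor :=
  [ffun i : m.-tuple 'I_n =>
     \sum_(j : m.-tuple 'I_n) A j * \prod_(k < m) P (tnth i k) (tnth j k)].

(* A x^(m-1): the i-th entry sums over the multi-indices (i, i_2, ..., i_m),
   i.e. over the m-tuples whose first element is i. *)
Definition tensor_app (A : tensor) (x : 'cV[C]_n) : 'cV[C]_n :=
  \col_i \sum_(j : m.-tuple 'I_n | ohead j == Some i)
           A j * \prod_(l <- behead j) x l 0.

Definition vec_pow (x : 'cV[C]_n) : 'cV[C]_n := \col_i x i 0 ^+ m.-1.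

Definition eigenvariety (A : tensor) (lambda : C) : set 'cV[C]_n :=
  [set x | tensor_app A x = lambda *: vec_pow x].

Definition is_eigenvalue (A : tensor) (lambda : C) : Prop :=
  exists x : 'cV[C]_n, x != 0 /\ tensor_app A x = lambda *: vec_pow x.

End Tensors.

Section Zariski.
Variables (C : comNzRingType) (n : nat).
Implicit Types V Z W F G : set 'cV[C]_n.

Definition zero_locus (S : set (mpoly.mpoly n C)) : set 'cV[C]_n :=
  [set x | forall p, S p -> mpoly.meval (fun i => x i 0) p = 0].

Definition zariski_closed F := exists S, F = zero_locus S.

(* Irreducibility in the subspace topology; the empty set is not irreducible. *)
Definition zariski_irreducible Z :=
  Z !=set0 /\
  forall F G, zariski_closed F -> zariski_closed G ->
    Z `<=` F `|` G -> Z `<=` F \/ Z `<=` G.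

(* The maximal irreducible subsets of V. *)
Definition irreducible_components V : set (set 'cV[C]_n) :=
  [set Z | [/\ Z `<=` V, zariski_irreducible Z &
    forall W, W `<=` V -> zariski_irreducible W -> Z `<=` W -> W = Z]].

Definition closed_in V Z := exists2 F, zariski_closed F & Z = V `&` F.

(* There are irreducible closed subsets Z 0 < Z 1 < ... < Z k of V
   (the values of Z beyond k are irrelevant). *)
Definition irreducible_chain V (k : nat) :=
  exists Z : nat -> set 'cV[C]_n,
    (forall i, (i <= k)%N -> closed_in V (Z i) /\ zariski_irreducible (Z i)) /\
    (forall i, (i < k)%N -> Z i `<` Z i.+1).

End Zariski.

(* Krull dimension: the supremum of the lengths of the chains above. It is an
   extended real, so that the supremum is total (-oo for the empty set). *)
Definition zariski_dim (R : realType) (n : nat) (V : set 'cV[R[i]]_n) : \bar R :=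
  ereal_sup [set (k%:R)%:E | k in irreducible_chain V].

Definition geometric_multiplicity (R : realType) (n m : nat)
    (A : tensor R[i] n m) (lambda : R[i]) : \bar R :=
  zariski_dim (eigenvariety A lambda).

Definition components_of_dim (R : realType) (n : nat) (V : set 'cV[R[i]]_n)
    (d : \bar R) : set (set 'cV[R[i]]_n) :=
  [set Z | irreducible_components V Z /\ zariski_dim Z = d].

(* Main.v *)
Require Import Defs.
From mathcomp Require Import all_boot all_order all_algebra.
From mathcomp Require Import complex.
From mathcomp Require Import boolp classical_sets functions cardinality.
From mathcomp Require Import reals ereal.
From mathcomp Require Import(canonicals) mpoly.
Set Implicit Arguments.
Unset Strict Implicit.
Unset Printing Implicit Defensive.
Import GRing.Theory.
Local Open Scope classical_set_scope.
Local Open Scope card_scope.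
Local Open Scope ring_scope.

(** Since [P^T P = I], the action satisfies [(P.A)(P x)^(m-1) = P (A x^(m-1))],
    so the linear automorphism [P] of the affine space carries the zero
    eigenvariety of [A] onto that of [P.A]. Polynomials are stable under linear
    substitution, so [P] is a homeomorphism for the Zariski topology, and it
    preserves irreducible components and Krull dimension. *)

Section TensorAction.
Variables (C : comNzRingType) (n : nat).

(** [bigA_distr_bigA] indexes by finite functions; the multi-indices of a [tensor] are tuples. *)
Lemma bigA_distr_tuple (I : finType) m (F : 'I_m -> I -> C) :
  \prod_k \sum_j F k j = \sum_(t : m.-tuple I) \prod_k F k (tnth t k).
Proof.
rewrite bigA_distr_bigA (reindex (fun t : m.-tuple I => [ffun k => tnth t k])).
  by apply: eq_bigr => t _; apply: eq_bigr => k _; rewrite ffunE.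
exists (fun f : {ffun 'I_m -> I} => [tuple f k | k < m]) => [t _ | f _].
  by apply: eq_from_tnth => k; rewrite tnth_mktuple ffunE.
by apply/ffunP => k; rewrite ffunE tnth_mktuple.
Qed.

(** Removes the filter from the sum in [tensor_app]: a tuple with prescribed head is determined by
    its tail. *)
Lemma big_tuple_ohead (I : finType) m (i : I) (G : m.+1.-tuple I -> C) :
  \sum_(j : m.+1.-tuple I | ohead j == Some i) G j
  = \sum_(t : m.-tuple I) G (cons_tuple i t).
Proof.
rewrite (reindex_onto (cons_tuple i) (fun j => [tuple of behead j])).
  apply: eq_bigl => t /=; rewrite eqxx /=.
  by apply/eqP/val_inj.
move=> j; case/tupleP: j => x t /= /eqP[->].
exact/val_inj.
Qed.

Lemma big_tuple_cons (I : finType) m (G : m.+1.-tuple I -> C) :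
  \sum_j G j = \sum_i \sum_(t : m.-tuple I) G (cons_tuple i t).
Proof.
rewrite (partition_big (@thead m I) predT) //=.
apply: eq_bigr => i _; rewrite -big_tuple_ohead.
by apply: eq_bigl => j; case/tupleP: j => x t; rewrite theadE.
Qed.

Lemma big_behead_cons_tuple (I : eqType) m (i : I) (t : m.-tuple I)
    (F : I -> C) :
  \prod_(l <- behead (cons_tuple i t)) F l = \prod_k F (tnth t k).
Proof. by rewrite /= big_tuple. Qed.

(** With [h] and [s] the head and tail of the index into [A], entry [i] of both sides expands to the
    sum over [h], [s], [t] of [A (h :: s) * P i h] times the product over [k] of
    [P t_k s_k * x t_k]. *)
Lemma tensor_app_act m (P : 'M[C]_n) (A : tensor C n m.+1) (x : 'cV[C]_n) :
  tensor_app (tensor_act P A) x = P *m tensor_app A (P^T *m x).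
Proof.
apply/colP => i; rewrite !mxE big_tuple_ohead.
under eq_bigr => t _ do
  rewrite ffunE big_behead_cons_tuple big_tuple_cons mulr_suml.
rewrite exchange_big /=; apply: eq_bigr => h _.
rewrite mxE big_tuple_ohead mulr_sumr.
under eq_bigr => t _ do rewrite mulr_suml.
rewrite exchange_big /=; apply: eq_bigr => s _.
rewrite big_tuple mulrCA.
under [in RHS]eq_bigr => k _ do rewrite mxE.
rewrite bigA_distr_tuple !mulr_sumr; apply: eq_bigr => t _.
(* The factor at position 0 of the action is [P i h]; the others pair with the entries of [x]. *)
rewrite big_ord_recl !tnth0 -!mulrA; congr (_ * (_ * _)).
rewrite -big_split /=; apply: eq_bigr => k _.
by rewrite !tnthS mxE.
Qed.

End TensorAction.

Section LinearChange.
Variables (C : comNzRingType) (n : nat).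
Implicit Types (P Q : 'M[C]_n) (V Z F : set 'cV[C]_n).

(** As a preimage, it commutes with intersections by computation. *)
Definition mulmx_pre P Z : set 'cV[C]_n := mulmx P @^-1` Z.

Lemma zariski_closed_pre P F :
  zariski_closed F -> zariski_closed (mulmx_pre P F).
Proof.
move=> [S ->].
(* Entry [i] is the linear form [(P x)_i], so composing with [l] pulls a polynomial back along
   [P]. *)
pose l := [tuple \sum_j P i j *: mpoly.mpolyX C (mpoly.mnm1 j) | i < n].
have evalE p (x : 'cV[C]_n) :
    mpoly.meval (fun i => x i 0) (mpoly.comp_mpoly l p)
    = mpoly.meval (fun i => (P *m x) i 0) p.
  rewrite mpoly.comp_mpoly_meval; apply: mpoly.meval_eq => i.
  rewrite tnth_mktuple raddf_sum mxE; apply: eq_bigr => j _ /=.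
  by rewrite mpoly.mevalZ mpoly.mevalXU.
exists [set mpoly.comp_mpoly l p | p in S].
apply/seteqP; split => x /= h; first by move=> _ [p Sp <-]; rewrite evalE h.
by move=> p Sp; rewrite -evalE; apply: h; exists p.
Qed.

Arguments zariski_closed_pre P [F].

Lemma mulmx_preK P Q : P *m Q = 1%:M -> cancel (mulmx_pre P) (mulmx_pre Q).
Proof.
by move=> PQ Z; apply/seteqP; split => x; rewrite /mulmx_pre /= mulmxA PQ mul1mx.
Qed.

Lemma mulmx_preS P Z F : Z `<=` F -> mulmx_pre P Z `<=` mulmx_pre P F.
Proof. exact: preimage_subset. Qed.

Arguments mulmx_preS P [Z F].

Lemma mulmx_pre_sub P Q Z F : P *m Q = 1%:M ->
  mulmx_pre P Z `<=` F -> Z `<=` mulmx_pre Q F.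
Proof. by move=> PQ /(mulmx_preS Q); rewrite mulmx_preK. Qed.

Lemma zariski_irreducible_pre P Q Z : P *m Q = 1%:M ->
  zariski_irreducible Z -> zariski_irreducible (mulmx_pre P Z).
Proof.
move=> PQ [[z Zz] Zirr]; have QP := mulmx1C PQ; split.
  by exists (Q *m z); rewrite /mulmx_pre /= mulmxA PQ mul1mx.
(* A closed cover of the pullback becomes, along [Q], a closed cover of [Z]. *)
move=> F G Fc Gc /(mulmx_pre_sub PQ) ZFG.
have [ZF|ZG] := Zirr _ _ (zariski_closed_pre Q Fc) (zariski_closed_pre Q Gc) ZFG.
  by left; rewrite -[F](mulmx_preK QP); apply: mulmx_preS.
by right; rewrite -[G](mulmx_preK QP); apply: mulmx_preS.
Qed.

Lemma irreducible_components_pre P Q V Z : P *m Q = 1%:M ->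
  irreducible_components V Z ->
  irreducible_components (mulmx_pre P V) (mulmx_pre P Z).
Proof.
move=> PQ [ZV Zirr Zmax]; have QP := mulmx1C PQ; split.
- exact: mulmx_preS.
- exact: zariski_irreducible_pre PQ Zirr.
(* Along [Q], [W] becomes an irreducible subset of [V] containing [Z], hence equal to [Z] by
   maximality. *)
- move=> W WV Wirr /(mulmx_pre_sub PQ) ZW.
  rewrite -[W](mulmx_preK QP); congr (mulmx_pre P _); apply: Zmax => //.
    by rewrite -[V](mulmx_preK PQ); apply: mulmx_preS.
  exact: zariski_irreducible_pre QP Wirr.
Qed.

Lemma irreducible_chain_pre P Q V k : P *m Q = 1%:M ->
  irreducible_chain V k -> irreducible_chain (mulmx_pre P V) k.
Proof.
move=> PQ [Z [Zirr Zlt]]; have QP := mulmx1C PQ.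
exists (fun i => mulmx_pre P (Z i)); split => i ik.
  have [[F Fc ZE] Ziirr] := Zirr i ik; split.
    by exists (mulmx_pre P F); [exact: zariski_closed_pre | rewrite ZE].
  exact: zariski_irreducible_pre PQ Ziirr.
have [ZS ZN] := Zlt i ik; split; first exact: mulmx_preS.
by move=> /(mulmx_preS Q); rewrite !mulmx_preK.
Qed.

End LinearChange.

Section ComplexLinearChange.
Variables (R : realType) (n : nat) (P Q : 'M[R[i]]_n).
Hypothesis PQ : P *m Q = 1%:M.

Lemma zariski_dim_pre V : zariski_dim (mulmx_pre P V) = zariski_dim V.
Proof.
rewrite /zariski_dim; congr (ereal_sup (image _ _)).
apply/seteqP; split => k; last exact: irreducible_chain_pre PQ.
(* The converse is the same transport along [Q], which brings the pullback of [V] back to [V]. *)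
by move/(irreducible_chain_pre (mulmx1C PQ)); rewrite mulmx_preK.
Qed.

Lemma card_irreducible_components_pre V :
  irreducible_components V #= irreducible_components (mulmx_pre P V).
Proof.
have QP := mulmx1C PQ; rewrite card_eq_sym.
suff -> : irreducible_components (mulmx_pre P V)
          = mulmx_pre P @` irreducible_components V.
  by apply: inj_card_eq => Z W _ _; apply: can_inj (mulmx_preK PQ) _ _.
apply/seteqP; split => Z.
  move=> /(irreducible_components_pre QP); rewrite mulmx_preK // => VZ.
  by exists (mulmx_pre Q Z) => //; rewrite mulmx_preK.
by move=> [W VW <-]; apply: irreducible_components_pre PQ VW.
Qed.

(** Equality of multisets of dimensions is counted value by value: the bijection on components
    preserves dimension, so it restricts to each [d]. *)
Lemma card_components_of_dim_pre V d :
  components_of_dim V d #= components_of_dim (mulmx_pre P V) d.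
Proof.
have QP := mulmx1C PQ; rewrite card_eq_sym.
suff -> : components_of_dim (mulmx_pre P V) d
          = mulmx_pre P @` components_of_dim V d.
  by apply: inj_card_eq => Z W _ _; apply: can_inj (mulmx_preK PQ) _ _.
apply/seteqP; split => Z.
  move=> [VZ dZ]; exists (mulmx_pre Q Z); last by rewrite mulmx_preK.
  split; last by rewrite -zariski_dim_pre mulmx_preK.
  by move: VZ => /(irreducible_components_pre QP); rewrite mulmx_preK.
move=> [W [VW dW] <-]; split; last by rewrite zariski_dim_pre.
exact: irreducible_components_pre PQ VW.
Qed.

End ComplexLinearChange.

(** At eigenvalue 0 the coordinate-dependent term [vec_pow] vanishes, leaving
    [P *m tensor_app A (P^T *m x) = 0], where the invertible [P] cancels. *)
Lemma eigenvariety0_act (C : comNzRingType) (n m : nat) (A : tensor C n m.+1)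
    (P : 'M[C]_n) : orthogonal_group P ->
  eigenvariety (tensor_act P A) 0 = mulmx_pre P^T (eigenvariety A 0).
Proof.
move=> PPT; rewrite /eigenvariety /mulmx_pre; apply/seteqP.
split => x; rewrite /= !scale0r tensor_app_act; last by move=> ->; rewrite mulmx0.
by move=> /(congr1 (mulmx P^T)); rewrite mulmxA (mulmx1C PPT) mul1mx mulmx0.
Qed.

Theorem proposition3p2 (R : realType) (m n : nat) (hm : (2 <= m)%N)
    (hn : (1 <= n)%N) (A : tensor R[i] n m) (hA : is_eigenvalue A 0)
    (P : 'M[R[i]]_n) (hP : orthogonal_group P) :
  [/\ irreducible_components (eigenvariety A 0)
        #= irreducible_components (eigenvariety (tensor_act P A) 0),
      forall d : \bar R,
        components_of_dim (eigenvariety A 0) d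
          #= components_of_dim (eigenvariety (tensor_act P A) 0) d &
      geometric_multiplicity A 0 = geometric_multiplicity (tensor_act P A) 0].
Proof.
case: m hm A hA => [//|m] _ A _.
(* The pullback is along [P^T], so the transport lemmas apply to [P^T] with inverse [P]. *)
have PTP : P^T *m P = 1%:M by apply: mulmx1C hP.
rewrite /geometric_multiplicity eigenvariety0_act //; split.
- exact: card_irreducible_components_pre PTP _.
- by move=> d; exact: card_components_of_dim_pre PTP _ _.
- by rewrite (zariski_dim_pre PTP).
Qed.
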